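(* Let $p$ be a prime. Then $\mathbb{Z}_p^m$ is a Černý group for all $m\geq 1$.
   Context: For a finite set $X$, $T_X$ is the set of all maps $X\to X$, acting on the right of $X$. An automaton with state set $X$ is a subset $\Sigma\subseteq T_X$, written $(X,\Sigma)$. The free monoid $\Sigma^*$ acts on the right of $X$ via the homomorphism $\Sigma^*\to T_X$ extending the inclusion $\Sigma\hookrightarrow T_X$. A word $w\in\Sigma^*$ is synchronizing if $|Xw|=1$; the automaton is synchronizing if it admits a synchronizing word. If $G$ is a finite group with generating set $\Delta$, elements of $\Delta$ are identified with the right translations $g\mapsto gd$ of $G$, so $\Delta\subseteq T_G$; the automaton $(G,\Delta)$ is the Cayley graph of $G$ with respect to $\Delta$. With $n=|G|$, $(G,\Delta)$ is a Černý Cayley graph if every synchronizing automaton $(G,\Sigma)$ with $\Delta\subseteq\Sigma\subseteq T_G$ admits a synchronizing word of length at most $(n-1)^2$. The group $G$ is a Černý group if $(G,\Delta)$ is a Černý Cayley graph for every generating set $\Delta$ of $G$. Here $\mathbb{Z}_p$ is the (additive) cyclic group of order $p$. *)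

(* Defs.v *)
From mathcomp Require Import all_boot all_order all_algebra all_fingroup.

Set Implicit Arguments.
Unset Strict Implicit.
Unset Printing Implicit Defensive.

Local Open Scope group_scope.

Section Automata.

Variable X : finType.

(* Maps act on the right of X: the point x moved by s is s x. *)
Definition transf := {ffun X -> X}.

Definition automaton := {set transf}.

(* The transformation induced by a word; the leftmost letter acts first, as
   required by a right action. *)
Definition word_map (w : seq transf) : transf :=
  [ffun x => foldl (fun y (s : transf) => s y) x w].

Definition is_word (Sigma : automaton) (w : seq transf) : bool :=
  all (fun s => s \in Sigma) w.

(* The condition |Xw| = 1. *)
Definition sync_word (w : seq transf) : bool :=
  #|[set word_map w x | x : X]| == 1%N.

Definition synchronizing (Sigma : automaton) : Prop :=
  exists w, is_word Sigma w && sync_word w.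

End Automata.

Section CernyGroups.

Variable gT : finGroupType.

Definition rtranslation (d : gT) : transf gT := [ffun g => g * d].

Definition cayley_graph (Delta : {set gT}) : automaton gT :=
  [set rtranslation d | d in Delta].

Definition cerny_cayley_graph (Delta : {set gT}) : Prop :=
  forall Sigma : automaton gT,
    cayley_graph Delta \subset Sigma -> synchronizing Sigma ->
    exists w, [&& is_word Sigma w, sync_word w
                & size w <= (#|gT| - 1) ^ 2]%N.

Definition cerny_group : Prop :=
  forall Delta : {set gT},
    <<Delta>> = [set: gT] -> cerny_cayley_graph Delta.

End CernyGroups.

Arguments cerny_group gT : clear implicits.

(* Main.v *)
Require Import Defs.
From HB Require Import structures.
From mathcomp Require Import all_boot all_order all_algebra all_fingroup.
From mathcomp Require Import all_solvable all_field all_character.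
From mathcomp Require Import zify.

(** Let G be elementary abelian of order n. It is enough to show that every
    proper nonempty subset S of G has a strictly larger preimage under some
    word of length at most n, since n - 2 such expansions, performed after one
    letter that identifies two points, give the bound (n - 1)^2
    ([sync_bound_of_expansion]).

    To expand S, write its indicator function as a combination of characters,
    and let A be the set of nontrivial characters that occur. Words act on
    functions on G by pullback. The span U of A has dimension #|A| and lies in
    the hyperplane V of functions of sum 0. A synchronizing word leads U out
    of V ([sync_escapes]), so by an ascending chain of subspaces a word t of
    length at most n - #|A| already does ([escape_word]). This means that the
    preimages of S under t followed by a translation do not all have size #|S|
    ([preim_translate_changes]); as their average size is #|S|, one of them,
    for a translation g, is larger ([preim_translate_grows]).

    It remains to reach g by a short word in the generators. Only the class of
    g modulo the common kernel K of A matters. If G / K has rank k, a word of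
    length at most k (p - 1) is enough, because the exponents of the
    generators can be taken below p ([short_product_mod]). On the other hand
    the indicator function of S is rational, so A is stable under the Galois
    group of the p-th cyclotomic field; separating G / K takes characters with
    at least k distinct kernels, and each kernel is shared by the p - 1
    conjugates of a character. Hence k (p - 1) is at most #|A|
    ([rank_le_card_Galois_closed]), and the total length is at most n. *)

Set Implicit Arguments.
Unset Strict Implicit.
Unset Printing Implicit Defensive.

Import GRing.Theory Num.Theory.

(** * Synchronization by successive expansions *)

Lemma word_map_nil (X : finType) (x : X) : word_map [::] x = x.
Proof. by rewrite ffunE. Qed.

Lemma word_map_cons (X : finType) (s : transf X) (w : seq (transf X)) (x : X) :
  word_map (s :: w) x = word_map w (s x).
Proof. by rewrite !ffunE. Qed.

Lemma word_map_cat (X : finType) (u v : seq (transf X)) (x : X) :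
  word_map (u ++ v) x = word_map v (word_map u x).
Proof. by rewrite !ffunE foldl_cat. Qed.

Lemma sync_word_const (X : finType) (w : seq (transf X)) :
  sync_word w -> exists x0, forall x, word_map w x = x0.
Proof.
case/cards1P=> x0 def_im; exists x0 => x.
by apply/set1P; rewrite -def_im imset_f.
Qed.

Lemma const_sync_word (X : finType) (w : seq (transf X)) (x0 : X) :
  (forall x, word_map w x = x0) -> sync_word w.
Proof.
move=> const_w; apply/cards1P; exists x0; apply/setP=> y; rewrite inE.
apply/imsetP/eqP=> [[x _ ->] // | ->].
by exists x0; rewrite ?const_w.
Qed.

Lemma word_map_inj (X : finType) (w : seq (transf X)) :
  (forall s : transf X, s \in w -> injective s) -> injective (word_map w).
Proof.
elim: w => [|s w IHw] inj_w x y; first by rewrite !word_map_nil.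
rewrite !word_map_cons => /IHw eq_s; apply: (inj_w s); first exact: mem_head.
by apply: eq_s => t wt; apply: inj_w; rewrite inE wt orbT.
Qed.

(** A composite of injections is injective, whereas a synchronizing word
    collapses everything to one point. *)
Lemma noninjective_letter (X : finType) (Sigma : automaton X) :
    synchronizing Sigma -> 1 < #|X| ->
  exists2 s, s \in Sigma & ~~ injectiveb s.
Proof.
case=> w /andP[Sw sync_w] X_gt1.
have [/hasP[s ws s_ninj] | /hasPn inj_w] :=
  boolP (has (fun s : transf X => ~~ injectiveb s) w).
  by exists s; rewrite ?(allP Sw).
have [x0 const_w] := sync_word_const sync_w.
have {}inj_w (s : transf X) : s \in w -> injective s.
  by move=> ws; apply/injectiveP; rewrite -[injectiveb s]negbK inj_w.
have: #|X| <= 1.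
  by apply/fintype_le1P=> x y; apply: (word_map_inj inj_w); rewrite !const_w.
by rewrite leqNgt X_gt1.
Qed.

(** Build the synchronizing word from its end. A letter that is not injective
    provides a point whose preimage already has two elements at the cost of
    one letter; then at most n - 2 expansions of length at most n make the
    preimage everything, and 1 + (n - 2) n = (n - 1)^2. *)
Lemma sync_bound_of_expansion (X : finType) (Sigma : automaton X) :
    synchronizing Sigma ->
    (forall S : {set X}, S != set0 -> S != [set: X] ->
      exists w, [&& is_word Sigma w, size w <= #|X|
                  & #|S| < #|word_map w @^-1: S|]) ->
  exists w, [&& is_word Sigma w, sync_word w & size w <= (#|X| - 1) ^ 2].
Proof.
move=> syncS expand.
have [x0 X_gt0] : exists x0 : X, 0 < #|X|.
  have [w0 /andP[_ /sync_word_const[x0 _]]] := syncS.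
  by exists x0; apply/card_gt0P; exists x0.
have [X_le1 | X_gt1] := leqP #|X| 1.
  exists [::]; apply/and3P; split=> //.
  apply: (@const_sync_word _ _ x0) => x.
  exact: (fintype_le1P X_le1).
have [s Ss /injectivePn[x [y neq_xy eq_sxy]]] :=
  noninjective_letter syncS X_gt1.
(* The minimum with n covers the steps made after the preimage is full. *)
have grow k : exists w, [&& is_word Sigma w, size w <= 1 + k * #|X|
    & minn #|X| (k + 2) <= #|word_map w @^-1: [set s x]|].
  elim: k => [|k [w /and3P[Sw size_w card_w]]].
    exists [:: s]; rewrite /is_word /= Ss /=; apply: leq_trans (geq_minr _ _) _.
    have -> : 0 + 2 = #|[set x; y]| by rewrite cards2 neq_xy.
    apply/subset_leq_card/subsetP=> z; rewrite !inE word_map_cons word_map_nil.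
    by case/pred2P=> ->; rewrite ?eq_sxy.
  set S := word_map w @^-1: _ in card_w.
  have [full | notfull] := eqVneq S setT.
    exists w; rewrite Sw -/S full cardsT geq_minl andbT (leq_trans size_w) //.
    by rewrite mulSn leq_add2l leq_addl.
  have S_n0 : S != set0.
    by rewrite -card_gt0; apply: leq_trans card_w; rewrite leq_min X_gt0 addnS.
  have [u /and3P[Su size_u lt_S]] := expand S S_n0 notfull.
  exists (u ++ w); rewrite /is_word all_cat [all _ u]Su [all _ w]Sw size_cat /=.
  have -> : word_map (u ++ w) @^-1: [set s x] = word_map u @^-1: S.
    by apply/setP=> z; rewrite !inE word_map_cat.
  rewrite mulSn addnCA leq_add //= (leq_trans _ lt_S) //.
  apply: leq_trans (_ : (minn #|X| (k + 2)).+1 <= _) => //.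
  by rewrite addSn -minnSS leq_min !geq_min leqnSn leqnn orbT.
have [w /and3P[Sw size_w card_w]] := grow (#|X| - 2).
have full : word_map w @^-1: [set s x] = setT.
  apply/eqP; rewrite eqEcard subsetT cardsT.
  by move: card_w; rewrite subnK // minnn.
exists w; rewrite Sw /=; apply/andP; split.
  apply: (@const_sync_word _ _ (s x)) => z; apply/set1P.
  have: z \in word_map w @^-1: [set s x] by rewrite full in_setT.
  by rewrite !inE.
apply: leq_trans size_w _; case: #|X| X_gt1 => [|[|n]] // _.
by rewrite !subSS !subn0 expnS expn1; lia.
Qed.

(** * Leaving a subspace along short words *)

(** The leftmost letter is applied last: this is the order for which pulling
    functions back along the letters of w is pulling them back along w. *)
Definition word_lfun (K : fieldType) (vT : vectType K) (I : Type)
  (f : I -> 'End(vT)) (w : seq I) : 'End(vT) :=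
  foldr (fun s g => (f s \o g)%VF) \1%VF w.

Lemma word_lfun_rcons (K : fieldType) (vT : vectType K) (I : Type)
    (f : I -> 'End(vT)) (w : seq I) (s : I) :
  word_lfun f (rcons w s) = (word_lfun f w \o f s)%VF.
Proof.
elim: w => [|t w IHw] /=; first by rewrite comp_lfun1l comp_lfun1r.
by rewrite IHw comp_lfunA.
Qed.

(** The ascending chain argument. Closing U under one more letter either
    leaves U unchanged, so that no word can lead out of V, or raises the
    dimension; as long as the result stays inside V this can happen at most
    dim V - dim U times. *)
Lemma escape_word (K : fieldType) (vT : vectType K) (I : finType)
    (f : I -> 'End(vT)) (P : {set I}) (U V : {vspace vT}) (w : seq I) :
    all [in P] w -> (U <= V)%VS -> ~~ (word_lfun f w @: U <= V)%VS ->
  exists t, [/\ all [in P] t, (size t + \dim U <= \dim V + 1)%N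
              & ~~ (word_lfun f t @: U <= V)%VS].
Proof.
move=> Pw; have [d] := ubnP (\dim V - \dim U).
elim: d U => // d IHd U lt_d sUV esc_w.
have [/exists_inP[s Ps esc_s] | ] := boolP [exists s in P, ~~ (f s @: U <= V)%VS].
  exists [:: s]; rewrite /= comp_lfun1r Ps.
  by split=> //; rewrite addnC leq_add2r dimvS.
rewrite negb_exists_in => /forall_inP stayV.
pose U1 := (U + \sum_(s in P) f s @: U)%VS.
have sUU1 : (U <= U1)%VS by apply: addvSl.
have sU1V : (U1 <= V)%VS.
  rewrite subv_add sUV; apply/subv_sumP=> s Ps.
  by have := stayV s Ps; rewrite negbK.
have [eqU | ltU] : U = U1 \/ (\dim U < \dim U1)%N.
  move: (dimvS sUU1); rewrite leq_eqVlt => /orP[eq_dim | lt_dim]; last by right.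
  by left; apply/eqP; rewrite eqEdim sUU1 (eqP eq_dim) leqnn.
  have stable t : all [in P] t -> (word_lfun f t @: U <= U)%VS.
    elim: t => [|s t IHt] /=; first by rewrite lim1g.
    case/andP=> Ps /IHt sub_t; rewrite limg_comp.
    apply: subv_trans (limgS _ sub_t) _; rewrite {2}eqU.
    by apply: subv_trans (addvSr _ _); rewrite (sumv_sup s).
  by case/negP: esc_w; apply: subv_trans (stable w Pw) sUV.
have [||t [Pt size_t esc_t]] := IHd U1 _ sU1V.
- by have := dimvS sU1V; lia.
- by apply: contra esc_w; apply: subv_trans; apply: limgS.
have [sub_tU | esc_tU] := boolP (word_lfun f t @: U <= V)%VS; last first.
  by exists t; split=> //; apply: leq_trans size_t; rewrite leq_add2l ltnW.
(* The word leads the enlarged space out of V but not U itself, so it does so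
   on the image of U under some letter, which is then added. *)
have /exists_inP[s Ps esc_ts] : [exists s in P,
    ~~ (word_lfun f (rcons t s) @: U <= V)%VS].
  apply: contraR esc_t; rewrite negb_exists_in => /forall_inP sub_ts.
  rewrite limgD subv_add sub_tU limg_sum; apply/subv_sumP=> s Ps.
  by have := sub_ts s Ps; rewrite negbK word_lfun_rcons limg_comp.
exists (rcons t s); split=> //; first by rewrite all_rcons Pt andbT.
by apply: leq_trans size_t; rewrite size_rcons addSnnS leq_add2l.
Qed.

(** * Short products modulo a subgroup *)

Section ShortProducts.

Local Open Scope group_scope.

(** Every element of an elementary abelian group G is congruent modulo K to a
    product of at most k (p - 1) generators, where p^k bounds the index of K.
    A generator d outside K has order p and meets K trivially, so enlarging K
    by d divides the index by p; the error in <[d]> that remains after the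
    recursive call is a power of d with exponent less than p. *)
Lemma short_product_mod (gT : finGroupType) (p k : nat) (Delta : {set gT})
    (K : {group gT}) (g : gT) :
    prime p -> p.-abelem [set: gT] -> <<Delta>> = [set: gT] ->
    (#|[set: gT]| <= #|K| * p ^ k)%N ->
  exists u, [/\ all [in Delta] u, (size u <= k * p.-1)%N
              & g^-1 * \prod_(d <- u) d \in K].
Proof.
move=> p_pr abelG genD; have [cGG Gp1] := abelemP p_pr abelG.
have p_gt1 := prime_gt1 p_pr; elim: k K => [|k IHk] K leGK.
  have -> : K = [set: gT]%G.
    by apply/val_inj/eqP; rewrite eqEcard subsetT -[#|K|]muln1.
  by exists [::]; rewrite inE.
have [sDK | /subsetPn[d Dd notKd]] := boolP (Delta \subset K).
  exists [::]; split=> //; suff -> : K = [set: gT]%G by rewrite inE.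
  by apply/val_inj/eqP; rewrite eqEsubset subsetT /= -genD gen_subG.
have ord_d : #[d] = p.
  apply: (nt_prime_order p_pr (Gp1 d (in_setT d))).
  by apply: contraNneq notKd => ->; apply: group1.
have nKd : <[d]> \subset 'N(K).
  by apply: cents_norm; apply: sub_abelian_cent2 cGG _ _; apply: subsetT.
have tiKd : K :&: <[d]> = 1.
  by rewrite setIC prime_TIg ?cycle_subG // -orderE ord_d.
have [|u [Du size_u Kdu]] := IHk (K <*> <[d]>)%G.
  by rewrite /= norm_joinEr // TI_cardMg // -orderE ord_d -mulnA -expnS.
move: Kdu; rewrite /= norm_joinEr // => /mulsgP[x _ Kx /cycleP[a ->] def_u].
(* The exponent is the representative of - a modulo p in 0, ..., p - 1. *)
exists (u ++ nseq ((p - a %% p) %% p) d); split.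
- by rewrite all_cat Du all_nseq Dd orbT.
- rewrite size_cat size_nseq mulSn addnC leq_add // -ltnS prednK ?prime_gt0 //.
  by rewrite ltn_mod prime_gt0.
rewrite big_cat /= mulgA def_u big_nseq iter_mulg mulg1.
rewrite -mulgA -expgD; suff -> : d ^+ (a + (p - a %% p) %% p) = 1 by rewrite mulg1.
apply/eqP; rewrite -order_dvdn ord_d /dvdn modnDmr -modnDml subnKC ?modnn //.
by rewrite ltnW ?ltn_mod ?prime_gt0.
Qed.

End ShortProducts.

(** * Galois-closed sets of characters *)

Section GaloisClosedSets.

Local Open Scope group_scope.
Local Open Scope ring_scope.

(** The quotient by the kernel of an irreducible character of an abelian group
    is cyclic, hence of order 1 or p here. *)
Lemma card_le_cfker (gT : finGroupType) (p : nat) (G : {group gT}) (i : Iirr G) :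
  prime p -> p.-abelem G -> (#|G| <= #|cfker 'chi_i| * p)%N.
Proof.
move=> p_pr abelG; have cGG := abelem_abelian abelG.
rewrite -(Lagrange (cfker_sub 'chi_i)) leq_mul2l -card_quotient ?cfker_norm //.
apply/orP; right.
have abelQ : p.-abelem (G / cfker 'chi_i)%g by apply: quotient_abelem.
have cycQ : cyclic (G / cfker 'chi_i)%g.
  have := cfcenter_cyclic 'chi_i; rewrite cfcenter_eq_center.
  by rewrite (center_idP (abelem_abelian abelQ)).
have [-> | ntQ] := eqVneq (G / cfker 'chi_i)%g 1%g;
  first by rewrite cards1 prime_gt0.
by rewrite (cyclic_abelem_prime abelQ).
Qed.

(** The Galois conjugates of a nontrivial character have the same kernel, and
    there are p - 1 of them: at a point x outside the kernel the character
    takes as value a primitive p-th root of unity z, and the automorphisms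
    raising p-th roots of unity to the powers 1, ..., p - 1 send z to distinct
    values. *)
Lemma card_same_cfker (gT : finGroupType) (p : nat) (G : {group gT})
    (A : {set Iirr G}) (i : Iirr G) :
    prime p -> p.-abelem G -> i != 0%R -> i \in A ->
    (forall (u : {rmorphism algC -> algC}) j, j \in A -> aut_Iirr u j \in A) ->
  (p.-1 <= #|[set j in A | cfker 'chi_j == cfker 'chi_i]|)%N.
Proof.
move=> p_pr abelG nz_i Ai closedA.
have cGG := abelem_abelian abelG; have p_gt0 := prime_gt0 p_pr.
have lin_i := char_abelianP _ cGG i.
have [x Gx ker'x] : exists2 x, x \in G & x \notin cfker 'chi_i.
  by apply/subsetPn; rewrite subGcfker.
set z := ('chi_i x)%R.
have zp1 : (z ^+ p = 1)%R.
  rewrite -lin_charX //; have [_ ->] // := abelemP p_pr abelG.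
  by rewrite lin_char1.
have prim_z : (p.-primitive_root z)%R.
  have [m prim_m dvd_mp] := prim_order_exists p_gt0 zp1.
  have [_ /(_ m dvd_mp)/pred2P[] def_m] := primeP p_pr.
    case/negP: ker'x; rewrite cfkerEirr inE.
    by move: prim_m; rewrite def_m => /prim_expr_order;
      rewrite expr1 /z lin_char1 // => ->.
  by rewrite -def_m.
have cop (a : 'I_p.-1) : coprime a.+1 p.
  rewrite coprime_sym prime_coprime // gtnNdvd // -[p in (_ < p)%N](prednK p_gt0).
  by rewrite ltnS.
pose h a := aut_Iirr (sval (Qn_aut_exists (cop a))) i.
have h_inj : injective h.
  move=> a b /(congr1 (fun j => 'chi_j x)); rewrite !aut_IirrE !cfunE.
  rewrite !(svalP (Qn_aut_exists _)) // => /eqP.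
  rewrite (eq_prim_root_expr prim_z) !modn_small
    -?[p in (_ < p)%N](prednK p_gt0) ?ltnS //.
  by rewrite eqSS => /eqP/val_inj.
rewrite -[p.-1]card_ord -(card_imset _ h_inj); apply/subset_leq_card/subsetP.
by move=> _ /imsetP[a _ ->]; rewrite inE closedA // aut_IirrE cfker_aut eqxx.
Qed.

(** With k the number of distinct kernels of the characters in A, the common
    kernel of A is an intersection of k subgroups of index at most p, while
    each of these kernels is shared by at least p - 1 characters of A. In
    other words, a faithful rational representation of an elementary abelian
    group of rank k has dimension at least k (p - 1). The induction removes
    all characters sharing one kernel at a time, which keeps A stable under
    the Galois action. *)
Lemma rank_le_card_Galois_closed (gT : finGroupType) (p : nat) (G : {group gT})
    (A : {set Iirr G}) :
    prime p -> p.-abelem G -> 0%R \notin A ->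
    (forall (u : {rmorphism algC -> algC}) j, j \in A -> aut_Iirr u j \in A) ->
  exists2 k, (k * p.-1 <= #|A|)%N
    & (#|G| <= #|G :&: \bigcap_(i in A) cfker 'chi_i| * p ^ k)%N.
Proof.
move=> p_pr abelG; have p_gt0 := prime_gt0 p_pr.
have [n] := ubnP #|A|; elim: n A => // n IHn A ltAn notA0 closedA.
have [-> | [i Ai]] := set_0Vmem A.
  by exists 0%N; rewrite ?big_set0 ?setIT ?muln1.
have nz_i : i != 0%R by apply: contraNneq notA0 => <-.
pose B := [set j in A | cfker 'chi_j == cfker 'chi_i].
have leB : (p.-1 <= #|B|)%N by apply: card_same_cfker.
have sBA : B \subset A by apply/subsetP=> j; rewrite inE => /andP[].
have cardA : (#|B| + #|A :\: B| = #|A|)%N.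
  by rewrite -(cardsID B A) (setIidPr sBA).
have Bi : i \in B by rewrite inE Ai eqxx.
have B_gt0 : (0 < #|B|)%N by apply/card_gt0P; exists i.
have [|||k le_k leG] := IHn (A :\: B).
- by lia.
- by rewrite inE negb_and notA0 orbT.
- move=> u j; rewrite !inE => /andP[notBj Aj]; move: notBj.
  by rewrite Aj closedA //= aut_IirrE cfker_aut andbT.
exists k.+1; first by rewrite mulSn; lia.
set L := \bigcap_(j in A :\: B) _ in leG; set K := \bigcap_(j in A) _.
have defK : G :&: K = (G :&: L) :&: cfker 'chi_i.
  rewrite -setIA; congr (_ :&: _); apply/setP=> x; rewrite inE.
  apply/bigcapP/andP=> [Kx | [/bigcapP Lx ker_x] j Aj].
    split; last exact: Kx.
    by apply/bigcapP=> j; rewrite inE => /andP[_]; apply: Kx.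
  have [] := boolP (j \in B); first by rewrite inE => /andP[_ /eqP->].
  by move=> notBj; apply: Lx; rewrite inE notBj.
have leker := card_le_cfker i p_pr abelG.
have mulGL : (#|G :&: L| * #|cfker 'chi_i| <= #|G| * #|G :&: K|)%N.
  rewrite defK mul_cardG leq_mul2r; apply/orP; right; apply: subset_leq_card.
  by rewrite mul_subG ?subsetIl ?cfker_sub.
rewrite -(@leq_pmul2l #|G|) ?cardG_gt0 //.
apply: leq_trans (leq_mul leG leker) _.
by rewrite mulnACA (mulnC _ p) -expnS mulnA leq_mul2r mulGL orbT.
Qed.

End GaloisClosedSets.

(** * Transformations acting on class functions *)

Section Pullback.

Local Open Scope group_scope.
Local Open Scope ring_scope.

Variable gT : finGroupType.
Hypothesis cGG : abelian [set: gT].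
Local Notation G := [set: gT].
Implicit Types (s : transf gT) (phi : 'CF(G)) (S : {set gT}).

(** On an abelian group every function is a class function; working with 'CF(G)
    gives access to the basis of irreducible characters. *)
Fact pullback_subproof s phi : is_class_fun <<G>> [ffun x => phi (s x)].
Proof.
apply: intro_class_fun => [x y _ Gy | x]; last by rewrite mem_gen ?inE.
by rewrite conjgE (centsP cGG x _ y) ?inE ?mulKg.
Qed.

Definition pullback s phi : 'CF(G) := Cfun 0 (pullback_subproof s phi).

Fact pullback_is_linear s : linear (pullback s).
Proof. by move=> a phi psi; apply/cfunP=> x; rewrite !cfunE. Qed.

HB.instance Definition _ s :=
  GRing.isSemilinear.Build algC 'CF(G) 'CF(G) _ (pullback s)
    (GRing.semilinear_linear (pullback_is_linear s)).

Definition pull s : 'End('CF(G)) := linfun (pullback s).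

Lemma word_pullE (w : seq (transf gT)) phi x :
  word_lfun pull w phi x = phi (word_map w x).
Proof.
elim: w x => [|s w IHw] x /=; first by rewrite id_lfunE word_map_nil.
by rewrite comp_lfunE lfunE cfunE IHw word_map_cons.
Qed.

Lemma cfun1_setTE x : (1 : 'CF(G)) x = 1.
Proof. by rewrite cfun1E inE. Qed.

Lemma cfdot_pull_indicator (w : seq (transf gT)) (g : gT) S :
  #|G|%:R * '[word_lfun pull w (pull (rtranslation g) '1_S), 1]
    = #|[set x | (word_map w x * g)%g \in S]|%:R.
Proof.
rewrite cfdotE mulVKf ?neq0CG // -sum1_card natr_sum big_mkcond /=.
rewrite [RHS]big_mkcond /=; apply: eq_bigr => x _.
rewrite !inE cfun1_setTE conjC1 mulr1 word_pullE lfunE cfunE ffunE.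
rewrite cfuniE; first by case: ifP.
by rewrite -sub_abelian_normal ?subsetT.
Qed.

Lemma pull_rtranslation_irr (g : gT) (i : Iirr G) :
  pull (rtranslation g) 'chi_i = 'chi_i g *: 'chi_i.
Proof.
apply/cfunP=> x; rewrite lfunE !cfunE ffunE lin_charM ?inE 1?mulrC //.
exact: (char_abelianP _ cGG i).
Qed.

(** The irreducible characters are eigenvectors of all translations. So, as a
    function of g, the size of the preimage of S under w followed by g is a
    combination of characters, where w only affects the coefficients. *)
Lemma preim_translate_spectrum (w : seq (transf gT)) (g : gT) S :
  #|[set x | (word_map w x * g)%g \in S]|%:R
    = #|G|%:R * (\sum_i ('['1_S, 'chi_i] * '[word_lfun pull w 'chi_i, 1])
                   *: 'chi_i) g.
Proof.
rewrite -cfdot_pull_indicator {1}['1_S]cfun_sum_cfdot !linear_sum /=.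
rewrite cfdot_suml sum_cfunE; congr (_ * _); apply: eq_bigr => i _.
by rewrite !linearZ /= pull_rtranslation_irr linearZ /= !cfdotZl !cfunE
           mulrCA mulrC.
Qed.

(** If every translate had preimage of size #|S|, then the function of g above
    would be constant, hence orthogonal to every nontrivial character. *)
Lemma preim_translate_changes (w : seq (transf gT)) S (i : Iirr G) :
    i != 0 -> '['1_S, 'chi_i] != 0 -> '[word_lfun pull w 'chi_i, 1] != 0 ->
  exists g, #|[set x | (word_map w x * g)%g \in S]| != #|S|.
Proof.
move=> nz_i nz_c nz_w; apply/existsP; apply: contraNT (mulf_neq0 nz_c nz_w).
rewrite negb_exists => /forallP const_card.
pose psi := \sum_i ('['1_S, 'chi_i] * '[word_lfun pull w 'chi_i, 1])
              *: 'chi_i.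
have <- : '[psi, 'chi_i] = '['1_S, 'chi_i] * '[word_lfun pull w 'chi_i, 1].
  rewrite cfdot_suml (bigD1 i) //= cfdotZl cfdot_irr eqxx mulr1 big1 ?addr0 //.
  by move=> j ne_ji; rewrite cfdotZl cfdot_irr (negPf ne_ji) mulr0.
have -> : psi = (#|S|%:R / #|G|%:R) *: 'chi_0.
  apply/cfunP=> g; rewrite cfunE irr0 cfun1_setTE mulr1.
  apply: canRL (mulfK (neq0CG _)) _; rewrite mulrC -preim_translate_spectrum.
  by have:= const_card g; rewrite negbK => /eqP->.
by rewrite cfdotZl cfdot_irr [0 == i]eq_sym (negPf nz_i) mulr0 eqxx.
Qed.

(** If no nontrivial character contributed, then the size of the preimage of S
    under w followed by a translation would not depend on the translation.
    But when w sends everything to one point x0, that size is #|G| or 0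
    according to whether the translate of x0 is in S. *)
Lemma sync_escapes (w : seq (transf gT)) S :
    sync_word w -> S != set0 -> S != [set: gT] ->
  exists i : Iirr G, [/\ i != 0, '['1_S, 'chi_i] != 0
                        & '[word_lfun pull w 'chi_i, 1] != 0].
Proof.
move=> /sync_word_const[x0 const_w] /set0Pn[y Sy] nfull.
have [z notSz] : exists z, z \notin S.
  apply/existsP; rewrite -negb_forall; apply: contra nfull => /forallP inS.
  by apply/eqP/setP=> z; rewrite inS inE.
pose cnt t := #|[set x | (word_map w x * (x0^-1 * t))%g \in S]|.
have cntE t : cnt t = if t \in S then #|gT| else 0%N.
  rewrite /cnt -cardsT -(cards0 gT); case: ifP => St; congr #|pred_of_set _|.
    by apply/setP=> x; rewrite !inE const_w mulKVg.
  by apply/setP=> x; rewrite !inE const_w mulKVg.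
have [/exists_inP[i nz_i] | ] := boolP [exists (i | i != 0),
    '['1_S, 'chi_i] * '[word_lfun pull w 'chi_i, 1] != 0].
  by rewrite mulf_eq0 negb_or => /andP[nz_c nz_w]; exists i.
rewrite negb_exists_in => /forall_inP coef0.
have const_cnt : cnt y = cnt z.
  apply/eqP; rewrite -(eqr_nat algC) !preim_translate_spectrum.
  apply/eqP; congr (_ * _); rewrite !sum_cfunE; apply: eq_bigr => i _.
  have [-> | nz_i] := eqVneq i 0; first by rewrite !cfunE irr0 !cfun1_setTE.
  by have:= coef0 i nz_i; rewrite negbK => /eqP->; rewrite !scale0r !cfunE.
have: (0 < #|gT|)%N by apply/card_gt0P; exists x0.
by move: const_cnt; rewrite !cntE Sy (negPf notSz) => ->.
Qed.

(** For each x the translates of f x run once through the whole group. *)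
Lemma sum_preim_translate (f : gT -> gT) S :
  (\sum_g #|[set x | (f x * g)%g \in S]| = #|gT| * #|S|)%N.
Proof.
under eq_bigr do rewrite -sum1_card big_mkcond.
rewrite exchange_big /= -sum_nat_const; apply: eq_bigr => x _.
rewrite -[RHS](card_imset _ (mulgI ((f x)^-1)%g)) -sum1_card [RHS]big_mkcond /=.
apply: eq_bigr => g _; rewrite inE; congr (if _ then _ else _).
apply/idP/imsetP=> [Sg | [h Sh ->]]; last by rewrite mulKVg.
by exists (f x * g)%g; rewrite ?mulKg.
Qed.

(** The average size of the preimages over all translates is #|S|, so if one
    of them differs from the average, another one exceeds it. *)
Lemma preim_translate_grows (f : gT -> gT) S (g0 : gT) :
    #|[set x | (f x * g0)%g \in S]| != #|S| ->
  exists g, (#|S| < #|[set x | (f x * g)%g \in S]|)%N.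
Proof.
move=> ne_g0; apply/existsP; apply: contraT.
rewrite negb_exists => /forallP small.
have le_card g : (#|[set x | (f x * g)%g \in S]| <= #|S|)%N.
  by rewrite leqNgt small.
have: (\sum_g #|[set x | (f x * g)%g \in S]| < \sum_(g : gT) #|S|)%N.
  rewrite (bigD1 g0) //= [X in (_ < X)%N](bigD1 g0) //= -addSn.
  by apply: leq_add; [rewrite ltn_neqAle ne_g0 le_card | apply: leq_sum].
by rewrite sum_preim_translate sum_nat_const ltnn.
Qed.

End Pullback.

(** * Elementary abelian groups *)

Section ElementaryAbelian.

Local Open Scope group_scope.
Local Open Scope ring_scope.

Lemma word_map_rtranslations (gT : finGroupType) (u : seq gT) (x : gT) :
  word_map (map (@rtranslation gT) u) x = (x * \prod_(d <- u) d)%g.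
Proof.
elim: u x => [|d u IHu] x /=; first by rewrite word_map_nil big_nil mulg1.
by rewrite word_map_cons IHu ffunE big_cons mulgA.
Qed.

(** The elements that the nontrivial characters occurring in the indicator
    function of S do not see are periods of S. *)
Lemma mem_mul_cfkers (gT : finGroupType) (S : {set gT}) (y h : gT) :
    abelian [set: gT] ->
    (forall i, i != 0 -> '['1_S, 'chi[[set: gT]]_i] != 0 -> h \in cfker 'chi_i) ->
  (y * h \in S)%g = (y \in S).
Proof.
move=> cGG ker_h.
have nS : S <| [set: gT] by rewrite -sub_abelian_normal ?subsetT.
pose phi : 'CF([set: gT]) := '1_S.
have eq_phi : phi (y * h)%g = phi y; last first.
  by move/eqP: eq_phi; rewrite !cfuniE // eqr_nat; do 2!case: (_ \in S).
rewrite /phi ['1_S]cfun_sum_cfdot !sum_cfunE; apply: eq_bigr => i _.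
rewrite !cfunE.
have [-> | nz_c] := eqVneq '['1_S, 'chi_i] 0; first by rewrite !mul0r.
have [-> | nz_i] := eqVneq i 0; first by rewrite irr0 !cfun1E !inE.
by rewrite cfkerMr // ker_h.
Qed.

(** Let A be the set of nontrivial characters that occur in the indicator
    function of S. Their span U lies in the hyperplane V of functions of sum 0
    and has dimension #|A|, so a word t of length at most n - #|A| leads U out
    of V; then t followed by some translation g expands S. The translation
    matters only modulo the common kernel of A, and a word in Delta of length
    at most #|A| reaches its class, because A is Galois-closed. The two
    lengths add up to at most n. *)
Lemma cayley_expansion (gT : finGroupType) (p : nat) (Delta : {set gT})
    (Sigma : automaton gT) (S : {set gT}) :
    prime p -> p.-abelem [set: gT] -> <<Delta>>%g = [set: gT] ->
    cayley_graph Delta \subset Sigma -> synchronizing Sigma ->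
    S != set0 -> S != [set: gT] ->
  exists w, [&& is_word Sigma w, size w <= #|gT|
              & #|S| < #|word_map w @^-1: S|]%N.
Proof.
move=> p_pr abelG genD sDS [w0 /andP[Sw0 sync_w0]] S_n0 S_nT.
have cGG := abelem_abelian abelG.
pose A := [set i : Iirr [set: gT] | (i != 0) && ('['1_S, 'chi_i] != 0)].
pose U := <<[seq 'chi_i | i <- enum A]>>%VS.
pose V := lker (linfun (cfdotr (1 : 'CF([set: gT])) : 'CF([set: gT]) -> algC^o)).
have memV phi : (phi \in V) = ('[phi, 1] == 0) by rewrite memv_ker lfunE.
have dimU : \dim U = #|A|.
  have freeA : free [seq 'chi_i | i <- enum A].
    apply: orthonormal_free; apply: sub_orthonormal (irr_orthonormal _).
      by move=> _ /mapP[i _ ->]; apply: mem_irr.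
    by rewrite (map_inj_uniq irr_inj) enum_uniq.
  by rewrite (eqP freeA) size_map -cardE.
have sUV : (U <= V)%VS.
  apply/span_subvP=> phi /mapP[i]; rewrite mem_enum inE => /andP[nz_i _] ->.
  by rewrite memV -irr0 cfdot_irr (negPf nz_i).
have dimV : (\dim V < #|gT|)%N.
  have <- : \dim {:'CF([set: gT])} = #|gT|.
    by rewrite dim_cfun; move: cGG; rewrite card_classes_abelian cardsT => /eqP.
  rewrite ltn_neqAle dimvS ?subvf // andbT; apply/negP=> eq_dim.
  have: 1 \in V.
    suff -> : V = fullv by apply: memvf.
    by apply/eqP; rewrite eqEdim subvf (eqP eq_dim) leqnn.
  by rewrite memV -irr0 cfdot_irr eqxx oner_eq0.
have escP w : reflect
    (exists2 i, i \in A & '[word_lfun (pull cGG) w 'chi_i, 1] != 0)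
    (~~ (word_lfun (pull cGG) w @: U <= V)%VS).
  rewrite limg_span -map_comp; apply: (iffP idP) => [not_sub | [i Ai esc_i]].
    apply/exists_inP; apply: contraR not_sub.
    rewrite negb_exists_in => /forall_inP stay.
    apply/span_subvP=> phi /mapP[i]; rewrite mem_enum memV => /stay.
    by rewrite negbK => coef0 ->.
  apply: contra esc_i => /span_subvP sub; rewrite -memV; apply: sub.
  by apply: map_f; rewrite mem_enum.
have esc_w0 : ~~ (word_lfun (pull cGG) w0 @: U <= V)%VS.
  have [i [nz_i nz_c esc_i]] := sync_escapes cGG sync_w0 S_n0 S_nT.
  by apply/escP; exists i; rewrite // inE nz_i.
have [t [St size_t /escP[i]]] :=
  escape_word (Sw0 : all [in Sigma] w0) sUV esc_w0.
rewrite inE => /andP[nz_i nz_c] esc_i.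
have [g0 /preim_translate_grows[g grow_g]] :=
  preim_translate_changes nz_i nz_c esc_i.
have [||k le_kA leGK] :=
  @rank_le_card_Galois_closed _ p [set: gT]%G A p_pr abelG.
- by rewrite inE eqxx.
(* The indicator function is rational, hence fixed by field automorphisms. *)
- move=> u j; rewrite !inE => /andP[nz_j nz_cj].
  rewrite aut_Iirr_eq0 nz_j aut_IirrE -(cfAut_cfuni u) cfdot_aut_irr.
  by rewrite fmorph_eq0.
rewrite setTI in leGK.
have [u [Du size_u ker_u]] := short_product_mod g p_pr abelG genD leGK.
pose w := t ++ map (@rtranslation gT) u.
exists w; apply/and3P; split.
- rewrite /is_word all_cat [all _ t]St all_map; apply: sub_all Du => d Dd /=.
  by apply: (subsetP sDS); apply: imset_f.
- rewrite size_cat size_map (leq_trans _ dimV) // -addn1.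
  by rewrite (leq_trans _ size_t) // leq_add2l dimU (leq_trans size_u).
suff -> : word_map w @^-1: S = [set x | (word_map t x * g)%g \in S] by [].
apply/setP=> x; rewrite !inE word_map_cat word_map_rtranslations.
rewrite -[(\prod_(d <- u) d)%g](mulKVg g) mulgA mem_mul_cfkers //.
by move=> j nz_j nz_cj; apply: (bigcapP ker_u); rewrite inE nz_j.
Qed.

Theorem abelem_cerny_group (gT : finGroupType) (p : nat) :
  prime p -> p.-abelem [set: gT] -> cerny_group gT.
Proof.
move=> p_pr abelG Delta genD Sigma sDS syncS.
by apply: sync_bound_of_expansion => // S;
  apply: (cayley_expansion p_pr abelG genD).
Qed.

End ElementaryAbelian.

(* The group law of the finGroupType 'rV['Z_p]_m is vector addition. *)
Theorem theorem5p2 (p m : nat) (hp : prime p) (hm : 1 <= m) :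
  cerny_group 'rV['Z_p]_m.
Proof.
(* By definition 'F_p is 'Z_(pdiv p). *)
by rewrite -(pdiv_id hp); apply: abelem_cerny_group (mx_Fp_abelem _ _ hp).
Qed.
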